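(* Let $A$ be a locally compact, totally disconnected abelian topological group whose Pontryagin dual $\widehat{A}$ is also locally compact and totally disconnected, let $H$ be a locally compact, totally disconnected group with a continuous homomorphism $t$ of $H$ into the automorphism group of $A$, and let $G=H\times_tA$ be the semidirect product. A smooth representation $\pi$ of $G$ on $V$ is irreducible if and only if the corresponding cosmooth system of imprimitivity for $H$ based on $\widehat{A}$ is irreducible. Two smooth representations of $G$ are equivalent if and only if the corresponding cosmooth systems of imprimitivity are equivalent.
   Context: All representations are on complex vector spaces. A representation of a locally compact totally disconnected group is smooth if every vector is fixed by some compact open subgroup. Write $h[a]=t_h(a)$. $G=H\times_tA$ is $H\times A$ with the product topology and multiplication $(h,a)(h',a')=(hh',a\,t_h(a'))$; it is a topological group. $H$ and $A$ are identified with the subgroups $\{(h,e_A)\}$ and $\{(e_H,a)\}$, so $hah^{-1}=h[a]$. $H$ acts continuously on $\widehat{A}$ (continuous unitary characters of $A$, compact-open topology) by $(h[\widehat{a}])(a)=\widehat{a}(h^{-1}[a])$. A projection valued measure $P$ based on $\widehat{A}$, acting on $V$, assigns to each open subset $E\subseteq\widehat{A}$ a linear operator $P_E$ on $V$ such that, for open subsets $E,F,E_i$ of $\widehat{A}$: (i) $P_{\widehat{A}}=\mathrm{I}$, $P_{\emptyset}=0$; (ii) $P_EP_F=P_{E\cap F}$; (iii) $P_{\bigcup E_i}=\sum P_{E_i}$ whenever $E_i\cap E_j=\emptyset$ for $i\neq j$. It is cosmooth if for every $v\in V$ there is a compact open $E(v)\subseteq\widehat{A}$ with $P_Ev=P_{E\cap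 E(v)}v$ for all open $E$. A cosmooth system of imprimitivity for $H$ based on $\widehat{A}$ is a triple $(\pi_2,P;V)$ with $\pi_2$ a smooth representation of $H$ on $V$ and $P$ a cosmooth projection valued measure based on $\widehat{A}$ acting on $V$ such that $\pi_2(h)P_E\pi_2(h)^{-1}=P_{h[E]}$ for all $h\in H$ and all open $E\subseteq\widehat{A}$. It is irreducible if there is no subspace other than $0$ and $V$ invariant under all $P_E$ and all $\pi_2(h)$. Two systems $(\pi_2,P;V)$ and $(\pi_2',P';V')$ are equivalent if there is an isomorphism $T$ from $V$ to $V'$ with $\pi_2'(h)=T\pi_2(h)T^{-1}$ and $P'_E=TP_ET^{-1}$ for all $h\in H$ and all open $E\subseteq\widehat{A}$. The cosmooth system of imprimitivity corresponding to a smooth representation $\pi$ of $G$ on $V$ is $(\pi|_H,P;V)$, where $P$ is the unique cosmooth projection valued measure based on $\widehat{A}$ such that $\pi(a)v=\int_{E(v)}x(a)\,dP(x)v$ for all $a\in A$, $v\in V$. Here, for $f$ locally constant on a compact open set $E=\bigsqcup_{i=1}^nE_i$, with $E_i$ compact open and $f=c_i$ on $E_i$, $\int_Ef(x)\,dP(x)v=\sum_ic_iP_{E_i}v$. *)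

(* Defs.v *)
From HB Require Import structures.
From mathcomp Require Import all_boot all_order all_algebra.
From mathcomp Require Import monoid complex.
From mathcomp Require Import all_classical all_reals all_analysis.

Set Implicit Arguments.
Unset Strict Implicit.
Unset Printing Implicit Defensive.

Import Order.TTheory GRing.Theory Num.Theory.
Import numFieldNormedType.Exports.

Local Open Scope classical_set_scope.
Local Open Scope ring_scope.

(* Keeping [R[i]] behind its numClosedFieldType gives it the topology of the
   norm. *)
Definition Cplx (R : realType) : numClosedFieldType := R[i].

#[short(type="preTopologicalGroupType")]
HB.structure Definition PreTopologicalGroup :=
  {G of Topological G & Group G}.

HB.mixin Record PreTopologicalGroup_isTopologicalGroup G
    & PreTopologicalGroup G := {
  mulg_continuous : continuous (fun x : G * G => (x.1 * x.2)%g) ;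
  invg_continuous : continuous (fun x : G => (x^-1)%g)
}.

#[short(type="topologicalGroupType")]
HB.structure Definition TopologicalGroup :=
  {G of PreTopologicalGroup G & PreTopologicalGroup_isTopologicalGroup G}.

(* The automorphism group of a topological abelian group.  An automorphism is
   stored together with its inverse, so that the topology induced by the
   product of compact-open topologies is the usual group topology (a basis at
   the identity consists of the f such that f(x) - x and f^-1(x) - x lie in U
   for x in K, with K compact and U a neighbourhood of 0). *)
Section Automorphisms.
Variable A : topologicalZmodType.

Definition automorphisms :
    set ({compact-open, A -> A} * {compact-open, A -> A})%type :=
  [set f : (A -> A) * (A -> A) |
    [/\ {morph f.1 : a b / a + b}, continuous f.1, continuous f.2,
        cancel f.1 f.2 & cancel f.2 f.1]].

Definition topAut : Type := set_type automorphisms.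

HB.instance Definition _ := Topological.on topAut.

Definition topAut_fun (f : topAut) : A -> A := (val f).1.

Definition mkAut f (fP : automorphisms f) : topAut := SigSub (mem_set fP).

Fact topAutP (f : topAut) : automorphisms (val f).
Proof. exact: set_mem (valP f). Qed.

Fact automorphisms1 : automorphisms (idfun, idfun).
Proof. by split=> // x; exact: cvg_id. Qed.

Fact automorphismsM (f g : topAut) :
  automorphisms ((val f).1 \o (val g).1, (val g).2 \o (val f).2).
Proof.
case: (topAutP f) => fD fc fic fK fiK; case: (topAutP g) => gD gc gic gK giK.
split=> /=.
- by move=> a b /=; rewrite gD fD.
- by move=> a; apply: continuous_comp; [exact: gc | exact: fc].
- by move=> a; apply: continuous_comp; [exact: fic | exact: gic].
- by move=> a /=; rewrite fK gK.
- by move=> a /=; rewrite giK fiK.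
Qed.

Fact automorphismsV (f : topAut) : automorphisms ((val f).2, (val f).1).
Proof.
case: (topAutP f) => fD fc fic fK fiK; split=> //= a b.
by apply: (can_inj fK); rewrite fD !fiK.
Qed.

Definition aut1 : topAut := mkAut automorphisms1.
Definition autM (f g : topAut) : topAut := mkAut (automorphismsM f g).
Definition autV (f : topAut) : topAut := mkAut (automorphismsV f).

Fact autMA : associative autM. Proof. by move=> f g h; exact: val_inj. Qed.
Fact aut1M : left_id aut1 autM.
Proof. by move=> f; apply: val_inj; rewrite /=; case: (val f). Qed.
Fact autM1 : right_id aut1 autM.
Proof. by move=> f; apply: val_inj; rewrite /=; case: (val f). Qed.
Fact autVM : left_inverse aut1 autV autM.
Proof.
move=> f; apply: val_inj; case: (topAutP f) => _ _ _ fK _ /=.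
by congr pair; apply/funext => a /=; exact: fK.
Qed.
Fact autMV : right_inverse aut1 autV autM.
Proof.
move=> f; apply: val_inj; case: (topAutP f) => _ _ _ _ fK /=.
by congr pair; apply/funext => a /=; exact: fK.
Qed.

HB.instance Definition _ :=
  isGroup.Build topAut autMA aut1M autM1 autVM autMV.

End Automorphisms.

(* A is written additively, so (h, a)(h', a') = (hh', a + t_h(a')). *)
Section SemidirectProduct.
Variables (H : topologicalGroupType) (A : topologicalZmodType).
Variable t : {multiplicative H -> topAut A}.

Local Notation "h [ a ]" := (topAut_fun (t h) a) (at level 2).

Definition semidirect : Type := let _ := t in (H * A)%type.

HB.instance Definition _ := Topological.copy semidirect (H * A)%type.

Definition sd_one : semidirect := (1%g, 0).
Definition sd_mul (x y : semidirect) : semidirect :=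
  ((x.1 * y.1)%g, x.2 + x.1[y.2]).
Definition sd_inv (x : semidirect) : semidirect :=
  ((x.1^-1)%g, - (x.1^-1)%g[x.2]).

Let tM h k a : (h * k)%g[a] = h[k[a]]. Proof. by rewrite gmulfM. Qed.
Let tD h : {morph topAut_fun (t h) : a b / a + b}.
Proof. by case: (topAutP (t h)). Qed.
Let t1 a : 1%g[a] = a.
Proof.
case: (topAutP (t 1%g)) => _ _ _ tK _; apply: (can_inj tK).
by rewrite [LHS](esym (tM _ _ _)) mulg1.
Qed.
Let t0 h : h[0] = 0.
Proof. by apply: (addrI (h[0])); rewrite -tD !addr0. Qed.
Let tN h a : h[- a] = - h[a].
Proof. by apply: (addrI (h[a])); rewrite -tD !subrr t0. Qed.

Fact sd_mulA : associative sd_mul.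
Proof. by move=> x y z; congr pair; rewrite /= ?mulgA// tM tD addrA. Qed.
Fact sd_mul1 : left_id sd_one sd_mul.
Proof. by move=> [h a]; congr pair; rewrite /= ?mul1g// t1 add0r. Qed.
Fact sd_1mul : right_id sd_one sd_mul.
Proof. by move=> [h a]; congr pair; rewrite /= ?mulg1// t0 addr0. Qed.
Fact sd_mulV : left_inverse sd_one sd_inv sd_mul.
Proof. by move=> x; congr pair; rewrite /= ?mulVg// addNr. Qed.
Fact sd_Vmul : right_inverse sd_one sd_inv sd_mul.
Proof. by move=> x; congr pair; rewrite /= ?mulgV// tN -tM mulgV t1 subrr. Qed.

HB.instance Definition _ :=
  isGroup.Build semidirect sd_mulA sd_mul1 sd_1mul sd_mulV sd_Vmul.

Definition sd_inl (h : H) : semidirect := (h, 0).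
Definition sd_inr (a : A) : semidirect := (1%g, a).

End SemidirectProduct.

Section Dual.
Variables (R : realType) (A : topologicalZmodType).
Local Notation C := (Cplx R).

Definition unitary_characters : set {compact-open, A -> C} :=
  [set x : A -> C | [/\ continuous x, {morph x : a b / a + b >-> a * b}
             & forall a : A, `|x a| = 1]].

Definition dual : Type := set_type unitary_characters.

HB.instance Definition _ := Topological.on dual.

Definition dual_fun (x : dual) : A -> C := val x.

Section Action.
Variables (H : topologicalGroupType) (t : {multiplicative H -> topAut A}).

Local Notation "h [ a ]" := (topAut_fun (t h) a) (at level 2).

Fact dual_act_subproof (h : H) (x : dual) :
  unitary_characters (fun a => dual_fun x ((h^-1)%g[a])).
Proof.
case: (set_mem (valP x)) => xc xM x1.
case: (topAutP (t (h^-1)%g)) => tD tc _ _ _.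
split=> [a|a b|a]; last exact: x1.
- by apply: continuous_comp; [exact: tc | exact: xc].
- by rewrite /topAut_fun tD; exact: xM.
Qed.

Definition dual_act (h : H) (x : dual) : dual :=
  SigSub (mem_set (dual_act_subproof h x)).

End Action.
End Dual.

Section Representations.
Variables (R : realType).
Local Notation C := (Cplx R).

Definition compact_open_subgroup (G : preTopologicalGroupType) (U : set G) :=
  [/\ open U, compact U & group_closed [in U]].

Definition is_smooth_rep (G : preTopologicalGroupType) (V : lmodType C)
    (pi : G -> {linear V -> V}) : Prop :=
  [/\ forall v, pi 1%g v = v,
      forall g h v, pi (g * h)%g v = pi g (pi h v)
    & forall v, exists2 U : set G, compact_open_subgroup U
                                 & forall g, U g -> pi g v = v].

Record smooth_rep (G : preTopologicalGroupType) (V : lmodType C) := SmoothRep {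
  rep_fun :> G -> {linear V -> V} ;
  rep_smooth : is_smooth_rep rep_fun
}.

Definition irreducible_rep (G : preTopologicalGroupType) (V : lmodType C)
    (pi : smooth_rep G V) : Prop :=
  forall W : {pred V}, submod_closed W ->
    (forall g v, v \in W -> pi g v \in W) ->
  W =i pred1 0 \/ W =i predT.

Definition equivalent_rep (G : preTopologicalGroupType) (V V' : lmodType C)
    (pi : smooth_rep G V) (pi' : smooth_rep G V') : Prop :=
  exists (T : {linear V -> V'}) (Ti : {linear V' -> V}),
    [/\ cancel T Ti, cancel Ti T & forall g v, pi' g v = T (pi g (Ti v))].

End Representations.

(* [D] is the class of sets on which the measure is defined, to be instantiated
   with all open sets or with all clopen sets; the values of [P] outside [D] are
   irrelevant.  Non-closed open sets make a real difference: on the locally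
   constant compactly supported functions on a non-discrete X, the
   multiplications by indicators of clopen sets form a cosmooth measure for the
   class of clopen sets which need not extend to all open sets.  Since V carries no topology, an infinite sum of
   operators is a pointwise sum having finitely many nonzero terms at each
   vector. *)
Section ProjectionValuedMeasures.
Variables (R : realType) (X : topologicalType) (V : lmodType (Cplx R)).
Local Notation C := (Cplx R).
Implicit Types (D : set (set X)) (P : set X -> {linear V -> V}).

Definition is_pvm D P : Prop :=
  [/\ (forall v, P setT v = v) /\ (forall v, P set0 v = 0),
      forall E F v, D E -> D F -> P E (P F v) = P (E `&` F) v
    & forall (I : choiceType) (E : I -> set X), (forall i, D (E i)) ->
        D (\bigcup_i E i) -> trivIset setT E ->
        forall v, finite_set [set i | P (E i) v != 0] /\
                  P (\bigcup_i E i) v = \sum_(i \in setT) P (E i) v].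

Definition concentrated D P (K : set X) (v : V) : Prop :=
  forall E, D E -> P E v = P (E `&` K) v.

Definition is_cosmooth_pvm D P : Prop :=
  is_pvm D P /\
  forall v, exists2 K : set X, compact K /\ open K & concentrated D P K v.

(* w is the integral over E of f(x) dP(x)v; this includes the existence of a
   partition of E as below, that is, the local constancy of f on E. *)
Definition is_pvm_integral P (E : set X) (f : X -> C) (v w : V) : Prop :=
  exists (n : nat) (F : 'I_n -> set X) (c : 'I_n -> C),
    [/\ forall i, compact (F i) /\ open (F i), trivIset setT F,
        E = \bigcup_i F i, forall i x, F i x -> f x = c i
      & w = \sum_(i < n) c i *: P (F i) v].

End ProjectionValuedMeasures.

Section SystemsOfImprimitivity.
Variables (R : realType) (A : topologicalZmodType) (H : topologicalGroupType).
Variable t : {multiplicative H -> topAut A}.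
Variable D : set (set (dual R A)).
Local Notation C := (Cplx R).
Local Notation "h [[ E ]]" := (dual_act t h @` E) (at level 2).

Record cosmooth_system (V : lmodType C) := CosmoothSystem {
  sys_rep : smooth_rep H V ;
  sys_pvm : set (dual R A) -> {linear V -> V} ;
  sys_cosmooth : is_cosmooth_pvm D sys_pvm ;
  sys_imprimitive : forall h E v, D E ->
    sys_rep h (sys_pvm E (sys_rep (h^-1)%g v)) = sys_pvm (h [[E]]) v
}.

Definition irreducible_system (V : lmodType C) (S : cosmooth_system V) : Prop :=
  forall W : {pred V}, submod_closed W ->
    (forall E v, D E -> v \in W -> sys_pvm S E v \in W) ->
    (forall h v, v \in W -> sys_rep S h v \in W) ->
  W =i pred1 0 \/ W =i predT.

Definition equivalent_system (V V' : lmodType C)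
    (S : cosmooth_system V) (S' : cosmooth_system V') : Prop :=
  exists (T : {linear V -> V'}) (Ti : {linear V' -> V}),
    [/\ cancel T Ti, cancel Ti T,
        forall h v, sys_rep S' h v = T (sys_rep S h (Ti v))
      & forall E v, D E -> sys_pvm S' E v = T (sys_pvm S E (Ti v))].

(* The compact open set E(v) is not unique; the integral does not depend on
   it. *)
Definition diagonalizes (V : lmodType C) (pi : smooth_rep (semidirect t) V)
    (P : set (dual R A) -> {linear V -> V}) : Prop :=
  forall a v K, compact K -> open K -> concentrated D P K v ->
    is_pvm_integral P K (fun x => dual_fun x a) v (pi (sd_inr t a) v).

Definition corresponding_system (V : lmodType C)
    (pi : smooth_rep (semidirect t) V) (S : cosmooth_system V) : Prop :=
  [/\ forall h v, sys_rep S h v = pi (sd_inl t h) v,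
      diagonalizes pi (sys_pvm S)
    & forall P, is_cosmooth_pvm D P -> diagonalizes pi P ->
        forall E v, D E -> P E v = sys_pvm S E v].

End SystemsOfImprimitivity.

(* Main.v *)
Require Import Defs.
From HB Require Import structures.
From mathcomp Require Import all_boot all_order all_algebra.
From mathcomp Require Import monoid complex.
From mathcomp Require Import all_classical all_reals all_analysis.

Set Implicit Arguments.
Unset Strict Implicit.
Unset Printing Implicit Defensive.

Import Order.TTheory GRing.Theory Num.Theory.
Import numFieldNormedType.Exports.

Local Open Scope classical_set_scope.
Local Open Scope ring_scope.

(** Everything rests on the translation between pi(a), for a in A, and the
    projections P_F, for F a compact open set of characters.

    From P to pi: if x(a) = c for all x in F, then pi(a) acts on the image of
    P_F as the scalar c (diagonalizes_eigen).  As every vector is a finite sum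
    of such components, a subspace stable under the projections is stable under
    A, and an isomorphism carrying P to P' carries pi(a) to pi'(a).

    From pi to P: on a compact open K, evaluation at a takes finitely many
    values, and the P of its level sets are the spectral projections of pi(a)
    on the vectors concentrated on K.  A subspace W stable under A contains the
    eigencomponents of its vectors (invariant_eigencomponents), hence is stable
    under the P of level sets.  The sets E in K with P_E W in W form a Boolean
    algebra; the level sets separate the characters, so by compactness this
    algebra contains every compact open subset of K
    (separating_algebra_compact_open).  Hence W is stable under P_F for every
    compact open F (invariant_compact_open).

    If the measure is defined on clopen sets only, then P_E v = P_F v with F the
    intersection of E and a compact open set on which v is concentrated, and
    this suffices.  On all open sets, a cosmooth measure is in general not
    determined by its values on compact open sets: on the ordinal omega_1 + 1,
    the open sets containing a closed unbounded subset of omega_1 have measure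
    one for a measure that agrees on clopen sets with the point mass at omega_1.
    What saves the argument is the uniqueness of P.  For each open E and each v,
    the values P_F v stabilize as the compact open F grows inside E, since
    otherwise infinitely many disjoint sets would have nonzero values at v.
    Their final values define a measure with the same values as P on compact
    open sets (regularized_pvm); it also diagonalizes pi, so it equals P, and
    again P_E v = P_F v for some compact open F
    (corresponding_inner_regular).

    That an equivalence of representations is one of systems follows from the
    uniqueness of P', by transporting P along the isomorphism. *)

(** * Compact open sets *)

Section CompactOpen.
Variable X : topologicalType.
Implicit Types (B E F K : set X) (G : set (set X)).

(** If no E in G covers B, the sets B minus E generate a proper filter on B, and
    a cluster point of it in B has no neighbourhood in G. *)
Lemma compact_directed_cover B G :
  compact B -> G set0 -> (forall E F, G E -> G F -> G (E `|` F)) ->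
  (forall x, B x -> exists2 E, G E & nbhs x E) ->
  exists2 E, G E & B `<=` E.
Proof.
move=> Bc G0 GU Gnbhs; apply: contrapT => noE.
pose S : set_system X := filter_from G (fun E => B `\` E).
have SF : ProperFilter S.
  apply: filter_from_proper.
    apply: filter_from_filter => [|E F GE GF]; first by exists set0.
    by exists (E `|` F); [exact: GU | rewrite setDUr].
  move=> E GE; apply/set0P/eqP => BE0.
  by apply: noE; exists E => //; rewrite -setD_eq0.
have SB : S B by exists set0 => //; exact: subDsetl.
have [x [/Gnbhs[E GE xE] clx]] := Bc S SF SB.
have SE : S (B `\` E) by exists E.
by have [y [[_]]] := clx _ _ SE xE.
Qed.

Definition compact_open_set K := compact K /\ open K.

Lemma compact_open0 : compact_open_set set0.
Proof. by split; [exact: compact0 | exact: open0]. Qed.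

Lemma compact_openU E F :
  compact_open_set E -> compact_open_set F -> compact_open_set (E `|` F).
Proof.
by move=> [Ec Eo] [Fc Fo]; split; [exact: compactU | exact: openU].
Qed.

Hypothesis hausX : hausdorff_space X.

Lemma compact_openI E F :
  compact_open_set E -> compact_open_set F -> compact_open_set (E `&` F).
Proof.
move=> [Ec Eo] [Fc Fo]; split; last exact: openI.
by apply: compact_closedI => //; exact: compact_closed.
Qed.

Lemma compact_openD E F :
  compact_open_set E -> compact_open_set F -> compact_open_set (E `\` F).
Proof.
move=> [Ec Eo] [Fc Fo]; rewrite setDE; split.
  by apply: compact_closedI => //; exact: open_closedC.
by apply: openI => //; apply: closed_openC; exact: compact_closed.
Qed.

Lemma compact_open_clopen E : compact_open_set E -> clopen E.
Proof. by move=> [Ec Eo]; split=> //; exact: compact_closed. Qed.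

(** Two applications of compactness: a separating Boolean algebra of open sets
    first isolates each point of E from the compact complement of E in K, and
    then E is a finite union of the isolating sets. *)
Lemma separating_algebra_compact_open K G :
  compact_open_set K -> G `<=` open -> G K ->
  (forall E F, G E -> G F -> G (E `&` F)) ->
  (forall E, G E -> E `<=` K /\ G (K `\` E)) ->
  (forall x y, K x -> K y -> x <> y -> exists2 E, G E & E x /\ ~ E y) ->
  forall E, compact_open_set E -> E `<=` K -> G E.
Proof.
move=> Kco Go GK GI GC Gsep E Eco EK.
have G0 : G set0 by rewrite -(setDv K); have [] := GC K GK.
have GU E1 E2 : G E1 -> G E2 -> G (E1 `|` E2).
  move=> GE1 GE2; have [[E1K GD1] [E2K GD2]] := (GC _ GE1, GC _ GE2).
  have [_] := GC _ (GI _ _ GD1 GD2); congr G.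
  by rewrite -setDUr setDD; apply/setIidPr => x [/E1K|/E2K].
have GD E1 E2 : G E1 -> G E2 -> G (E1 `\` E2).
  move=> GE1 GE2; have [[E1K _] [_ GD2]] := (GC _ GE1, GC _ GE2).
  by have := GI _ _ GE1 GD2; rewrite setIDA (setIidl E1K).
have isolate x : E x -> exists2 U, G U & U x /\ U `<=` E.
  move=> Ex.
  have [KEc _] := compact_openD Kco Eco.
  have [||y [Ky nEy]|U [GU' nUx] KEU] := compact_directed_cover
    (G := [set U | G U /\ ~ U x]) KEc.
  - by split.
  - by move=> U V [? ?] [? ?]; split; [exact: GU | case].
  - have [|U GU' [Ux nUy]] := Gsep x y (EK _ Ex) Ky.
      by move=> xy; rewrite xy in Ex.
    have [_ GKU] := GC _ GU'; exists (K `\` U); first by split=> // -[].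
    by apply: open_nbhs_nbhs; split; [exact: Go | split].
  - exists (K `\` U); first by have [] := GC _ GU'.
    split; first by split=> //; exact: EK.
    by move=> y [Ky nUy]; apply: contrapT => nEy; apply/nUy/KEU.
have [||x /isolate[U GU' [Ux UE]]|U [GU' UE] EU] := compact_directed_cover
  (G := [set U | G U /\ U `<=` E]) Eco.1.
- by split.
- by move=> U V [? ?] [? ?]; split; [exact: GU | rewrite subUset].
- exists U; first by split.
  by apply: open_nbhs_nbhs; split; [exact: Go |].
- by rewrite (_ : E = U) //; apply/seteqP.
Qed.

End CompactOpen.

(** * Projection valued measures on a Hausdorff space *)

Lemma fsbig_finType (V : nmodType) (I : finType) (f : I -> V) :
  \sum_(i \in setT) f i = \sum_i f i.
Proof.
rewrite (fsbigE (index_enum I)) ?index_enum_uniq //.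
  by apply: eq_bigl => i; rewrite in_setT.
by move=> i _; rewrite mem_index_enum.
Qed.

Section Measures.
Variables (R : realType) (X : topologicalType) (V : lmodType (Cplx R)).
Hypothesis hausX : hausdorff_space X.
Variables (D : set (set X)) (P : set X -> {linear V -> V}).
Hypotheses (DT : D setT) (Dco : @compact_open_set X `<=` D).
Hypothesis pvmP : is_pvm D P.
Implicit Types (E F K : set X) (v : V).

Lemma pvmT v : P setT v = v. Proof. by case: (pvmP) => -[]. Qed.
Lemma pvm0 v : P set0 v = 0. Proof. by case: (pvmP) => -[]. Qed.
Lemma pvmI E F v : D E -> D F -> P E (P F v) = P (E `&` F) v.
Proof. by case: (pvmP) => _ + _; exact. Qed.

Lemma pvm_sum (I : finType) (F : I -> set X) v :
  (forall i, D (F i)) -> D (\bigcup_i F i) -> trivIset setT F ->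
  P (\bigcup_i F i) v = \sum_i P (F i) v.
Proof.
move=> DF DU tF; case: (pvmP) => _ _ /(_ I F DF DU tF v)[_ ->].
exact: fsbig_finType.
Qed.

Lemma pvmD E F v : compact_open_set E -> compact_open_set F ->
  P E v = P (E `&` F) v + P (E `\` F) v.
Proof.
move=> Eco Fco; pose G b := if b then E `&` F else E `\` F.
have GU : \bigcup_b G b = E.
  apply/seteqP; split=> [x [[] _ []]//|x Ex].
  by have [Fx|nFx] := pselect (F x); [exists true | exists false].
rewrite -{1}GU pvm_sum ?big_bool //.
- by move=> [] /=; apply: Dco; [exact: compact_openI | exact: compact_openD].
- by rewrite GU; exact: Dco.
- by move=> [] [] _ _ //= [x [[? ?] [? ?]]].
Qed.

Lemma concentratedP K v : D K -> concentrated D P K v <-> P K v = v.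
Proof.
move=> DK; split=> [/(_ setT DT)|PKv E DE]; first by rewrite setTI pvmT => <-.
by rewrite -[in LHS]PKv pvmI.
Qed.

Lemma concentrated_pvm K v : D K -> concentrated D P K (P K v).
Proof. by move=> DK; apply/concentratedP => //; rewrite pvmI // setIid. Qed.

End Measures.

(** * Inner regularization of a measure on the open sets *)

Section Regularization.
Variables (R : realType) (X : topologicalType) (V : lmodType (Cplx R)).
Hypothesis hausX : hausdorff_space X.
Let D : set (set X) := [set E | open E].
Variable P : set X -> {linear V -> V}.
Hypothesis cpvmP : is_cosmooth_pvm D P.
Let pvmP : is_pvm D P := proj1 cpvmP.
Implicit Types (E F K : set X) (u v : V).

Let DT : D setT. Proof. exact: openT. Qed.
Let Dco : @compact_open_set X `<=` D. Proof. by move=> E []. Qed.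

(** F carries the part of v seen by the compact open subsets of E. *)
Definition inner_support E v F := [/\ compact_open_set F, F `<=` E
  & forall K, compact_open_set K -> K `<=` E -> P K v = P (K `&` F) v].

Lemma inner_support_uniq E v F K :
  inner_support E v F -> inner_support E v K -> P F v = P K v.
Proof.
move=> [Fco FE supF] [Kco KE supK].
by rewrite (supK F) // (supF K) // setIC.
Qed.

Lemma inner_supportS E v F K : compact_open_set K -> F `<=` K -> K `<=` E ->
  inner_support E v F -> inner_support E v K.
Proof.
move=> Kco FK KE [Fco FE supF]; split=> // L Lco LE.
rewrite supF // [RHS]supF; [|exact: compact_openI|by move=> x [/LE]].
by rewrite -setIA (setIidr FK).
Qed.

(** Were there no such F, each stage of an increasing sequence of compact open
    subsets of E could be enlarged by a set on which v has a nonzero component;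
    the increments are disjoint, against the finiteness in the additivity. *)
Lemma inner_support_ex E v : exists F, inner_support E v F.
Proof.
apply: contrapT => noF.
pose T := {F | compact_open_set F /\ F `<=` E}.
have grow (F : T) :
    {K | (compact_open_set K /\ K `<=` E) /\ P K v <> P (K `&` sval F) v}.
  apply: cid; case: F => F [Fco FE] /=; apply: contrapT => noK; apply: noF.
  exists F; split=> // K Kco KE; apply: contrapT => neqK.
  by apply: noK; exists K.
have next (F : T) :
    compact_open_set (sval F `|` sval (grow F)) /\
    sval F `|` sval (grow F) `<=` E.
  case: (grow F) => K [[Kco KE] _] /=; case: F => F [Fco FE] /=.
  by split; [exact: compact_openU | rewrite subUset].
pose F n : T := iter n (fun F : T => exist _ _ (next F) : T)
  (exist _ set0 (conj (compact_open0 X) (@sub0set _ E))).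
pose G n := sval (grow (F n)) `\` sval (F n).
have Fco n : compact_open_set (sval (F n)) by have [] := svalP (F n).
have Gco n : compact_open_set (G n).
  by have [[? _] _] := svalP (grow (F n)); exact: compact_openD.
have GF m n : (m < n)%N -> G m `<=` sval (F n).
  elim: n => // n IHn; rewrite ltnS leq_eqVlt => /predU1P[->|/IHn mn] x Gx /=.
    by right; case: Gx.
  by left; exact: mn.
have tG : trivIset setT G.
  apply: ltn_trivIset => m n mn; apply/seteqP; split=> // x [Gm [_]]; apply.
  exact: GF Gm.
case: (pvmP) => _ _ /(_ nat G (fun n => Dco (Gco n)) _ tG v)[].
  by apply: bigcup_open => n _; case: (Gco n).
move=> + _; rewrite (_ : [set _ | _] = setT); first exact: infinite_nat.
apply/seteqP; split=> // n _ /=; have [[Kco _] neqK] := svalP (grow (F n)).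
apply/eqP => PG0; apply: neqK.
by rewrite (pvmD hausX Dco pvmP _ Kco (Fco n)) -/(G n) PG0 addr0.
Qed.

Definition inner_set E v := sval (cid (inner_support_ex E v)).

Lemma inner_setP E v : inner_support E v (inner_set E v).
Proof. exact: svalP (cid _). Qed.

Definition regularized_fun E v := P (inner_set E v) v.

Lemma regularizedE E v F :
  inner_support E v F -> regularized_fun E v = P F v.
Proof. exact: inner_support_uniq (inner_setP E v). Qed.

Lemma regularized_linear E : linear (regularized_fun E).
Proof.
move=> c u v; pose F := inner_set E u `|` inner_set E v.
have [uco uE _] := inner_setP E u; have [vco vE _] := inner_setP E v.
have Fco : compact_open_set F by exact: compact_openU.
have FE : F `<=` E by rewrite subUset.
have uF : inner_support E u F.
  by apply: (inner_supportS Fco _ FE (inner_setP E u)) => x; left.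
have vF : inner_support E v F.
  by apply: (inner_supportS Fco _ FE (inner_setP E v)) => x; right.
rewrite (regularizedE uF) (regularizedE vF) (@regularizedE _ _ F) ?linearP //.
case: uF vF => _ _ uF [_ _ vF]; split=> // K Kco KE.
by rewrite !linearP /= uF // vF.
Qed.

HB.instance Definition _ E := GRing.isLinear.Build (Cplx R) V V *:%R
  (regularized_fun E) (@regularized_linear E).

Definition regularized E : {linear V -> V} := regularized_fun E.

Lemma inner_support_compact K v : compact_open_set K -> inner_support K v K.
Proof. by move=> Kco; split=> // L _ /setIidPl ->. Qed.

Lemma regularized_compact K v : compact_open_set K -> regularized K v = P K v.
Proof. by move=> Kco; exact/regularizedE/inner_support_compact. Qed.

(** For the direct implication it is enough that the two measures agree at K:
    being concentrated on K is being fixed by the projection of K. *)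
Lemma regularized_concentrated K v : compact_open_set K ->
  concentrated D regularized K v <-> concentrated D P K v.
Proof.
move=> Kco; split=> [rK|PK E DE].
  apply/(concentratedP DT pvmP _ (Dco Kco)); rewrite -regularized_compact //.
  rewrite -[K in regularized K]setTI -rK //.
  have [L [Lc Lo] PL] := cpvmP.2 v.
  rewrite [LHS](@regularizedE _ _ L); first exact/(concentratedP DT pvmP _ Lo).
  by split=> // M [_ Mo] _; exact: PL.
have [Fco FE supF] := inner_setP E v.
rewrite [LHS](regularizedE (And3 Fco FE supF)).
rewrite [RHS](@regularizedE _ _ (inner_set E v `&` K)); first exact/PK/Dco.
split=> [||L Lco LEK]; [exact: compact_openI|exact: setSI|].
have LK : L `<=` K by move=> x /LEK[].
rewrite supF //; last by move=> x /LEK[].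
by rewrite (setIC _ K) [in RHS]setIA (setIidl LK).
Qed.

(** Disjoint open sets cover a compact subset of their union by compact open
    pieces, so the additivity of the regularized measure is that of P on the
    pieces of one inner support. *)
Lemma regularized_pvm : is_cosmooth_pvm D regularized.
Proof.
split; last first.
  move=> v; have [K Kco PK] := cpvmP.2 v; exists K => //.
  by apply/regularized_concentrated.
split.
- split=> v.
    have [K Kco PK] := cpvmP.2 v.
    have [Kc Ko] := Kco; rewrite [LHS](@regularizedE _ _ K).
      exact/(concentratedP DT pvmP _ Ko).
    by split=> // L [_ Lo] _; exact: PK.
  by rewrite regularized_compact ?(pvm0 pvmP) //; exact: compact_open0.
- move=> E1 E2 v _ _.
  have [F2co F2E supF2] := inner_setP E2 v.
  have -> : regularized E2 v = P (inner_set E2 v) v by exact: regularizedE.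
  set F2 := inner_set E2 v in F2co F2E supF2 *.
  have [F1co F1E supF1] := inner_setP E1 (P F2 v).
  rewrite [LHS](regularizedE (And3 F1co F1E supF1)).
  set F1 := inner_set E1 _ in F1co F1E supF1 *.
  rewrite (pvmI pvmP _ (Dco F1co) (Dco F2co)).
  rewrite [RHS](@regularizedE _ _ (F1 `&` F2)) //.
  split=> [||K Kco KE]; [exact: compact_openI|exact: setISS|].
  have KE1 : K `<=` E1 by move=> x /KE[].
  have KE2 : K `<=` E2 by move=> x /KE[].
  have KF1 := compact_openI hausX Kco F1co.
  rewrite supF2 // -(pvmI pvmP _ (Dco Kco) (Dco F2co)) supF1 //.
  by rewrite (pvmI pvmP _ (Dco KF1) (Dco F2co)) setIA.
- move=> I E DE DU tE v.
  pose F i := inner_set (E i) v.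
  have FP i : inner_support (E i) v (F i) by exact: inner_setP.
  have Fco i : compact_open_set (F i) by case: (FP i).
  have FE i : F i `<=` E i by case: (FP i).
  have tF : trivIset setT F.
    by move=> i j _ _ [x [/FE Ei /FE Ej]]; apply: tE => //; exists x.
  split.
    case: (pvmP) => _ _ /(_ I F (fun i => Dco (Fco i)) _ tF v)[] //.
    by apply: bigcup_open => i _; exact: Dco.
  have [Gco GE supG] := inner_setP (\bigcup_i E i) v.
  rewrite [LHS](regularizedE (And3 Gco GE supG)).
  set G := inner_set _ v in Gco GE supG *.
  have GEU : \bigcup_i (G `&` E i) = G.
    by rewrite -setI_bigcupr; exact/setIidPl.
  have GEco i : compact_open_set (G `&` E i).
    split; last by apply: openI; [case: Gco | exact: DE].
    (* Being disjoint from the other E j, the set E i is closed in G. *)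
    have -> : G `&` E i = G `&` ~` (\bigcup_(j in [set~ i]) E j).
      apply/seteqP; split=> x [Gx nE]; split=> //.
        by move=> [j /= ji Ej]; apply: ji; apply: tE => //; exists x.
      have [j _ Ej] := GE _ Gx; have [<-//|ji] := eqVneq j i.
      by case: nE; exists j => //=; exact/eqP.
    apply: compact_closedI; first by case: Gco.
    by apply: open_closedC; apply: bigcup_open => j _; exact: DE.
  case: (pvmP) => _ _ /(_ I (fun i => G `&` E i)) addGE.
  rewrite -[in LHS]GEU (addGE _ _ _ v).2; first last.
  - exact: trivIset_setIl.
  - by rewrite GEU; exact: Dco.
  - by move=> i; exact/Dco/GEco.
  apply: eq_fsbigr => i _; have [_ _ supF] := FP i.
  rewrite (supF _ (GEco i)); last exact: subIsetr.
  have FiE : F i `<=` \bigcup_i E i by move=> x /FE Ex; exists i.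
  by rewrite -setIA (setIidr (FE i)) setIC -supG.
Qed.

End Regularization.

(** * Characters and the restriction of a representation to A *)

Lemma dual_separated (R : realType) (A : topologicalZmodType) (x y : dual R A) :
  x <> y -> exists a, dual_fun x a <> dual_fun y a.
Proof.
move=> xy; apply: contrapT => noa; apply/xy/val_inj/funext => a.
by apply: contrapT => ?; apply: noa; exists a.
Qed.

Lemma dual_fun_continuous (R : realType) (A : topologicalZmodType) (a : A) :
  continuous (fun x : dual R A => dual_fun x a).
Proof.
apply/continuousP => O Oo.
rewrite (_ : _ @^-1` O =
    (val : dual R A -> {compact-open, A -> Cplx R}) @^-1`
      [set g | g @` [set a] `<=` O]).
  apply: open_comp; first by move=> x _; exact: initial_continuous.
  by apply: compact_open_open => //; exact: compact_set1.
by apply/seteqP; split=> [x Ox _ [_ -> <-]//|x /=]; apply; exists a.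
Qed.

Lemma dual_hausdorff (R : realType) (A : topologicalZmodType) :
  hausdorff_space (dual R A).
Proof.
move=> x y clxy; apply: contrapT => /dual_separated[a]; apply.
apply: (@norm_hausdorff _ (Cplx R)) => O1 O2 O1x O2y.
have [z [zO1 zO2]] :=
  clxy _ _ (dual_fun_continuous O1x) (dual_fun_continuous O2y).
by exists (dual_fun z a).
Qed.

(** With u the sum of the w c, the vector T u - d u has the components
    (c - d) w c and no component along d, so that induction applies. *)
Lemma invariant_eigencomponents (K : fieldType) (V : lmodType K)
    (W : {pred V}) (T : {linear V -> V}) (s : seq K) (w : K -> V) :
  submod_closed W -> (forall v, v \in W -> T v \in W) ->
  uniq s -> (forall c, c \in s -> T (w c) = c *: w c) ->
  \sum_(c <- s) w c \in W -> forall c, c \in s -> w c \in W.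
Proof.
move=> Wsub WT.
have [W0 WZD] := Wsub.
have WZ c v : v \in W -> c *: v \in W.
  by move=> Wv; rewrite -[c *: v]addr0 WZD.
have WB u v : u \in W -> v \in W -> u - v \in W.
  by move=> Wu Wv; rewrite addrC -scaleN1r WZD.
elim: s w => // d s IHs w /= /andP[ds us] Tw; rewrite big_cons => Ww.
have Ws c : c \in s -> w c \in W.
  move=> cs; have cd : c - d != 0.
    by rewrite subr_eq0; apply: contraNneq ds => <-.
  rewrite -[w c](scalerK cd) WZ //.
  apply: (IHs (fun c => (c - d) *: w c)) => // [e es|].
    by rewrite linearZ /= Tw ?inE ?es ?orbT // !scalerA mulrC.
  rewrite (_ : \sum_(c <- s) _ = T (w d + \sum_(c <- s) w c) -
      d *: (w d + \sum_(c <- s) w c)).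
    by apply: WB; [exact: WT | exact: WZ].
  rewrite linearD /= Tw ?mem_head // scalerDr opprD addrACA subrr add0r.
  rewrite linear_sum scaler_sumr -sumrB /=.
  by apply: eq_big_seq => e es; rewrite Tw ?inE ?es ?orbT // scalerBl.
move=> c; rewrite inE => /predU1P[->|]; last exact: Ws.
rewrite -[w d](addrK (\sum_(c <- s) w c)); apply: WB => //.
rewrite big_seq; elim/big_rec: _ => // e v es Wv.
by rewrite -[w e]scale1r WZD // Ws.
Qed.

Section Diagonalization.
Variables (R : realType) (A : topologicalZmodType) (H : topologicalGroupType).
Variables (t : {multiplicative H -> topAut A}) (V : lmodType (Cplx R)).
Variable pi : smooth_rep (semidirect t) V.
Variables (D : set (set (dual R A))) (P : set (dual R A) -> {linear V -> V}).
Hypotheses (DT : D setT) (Dco : @compact_open_set (dual R A) `<=` D).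
Hypotheses (cpvmP : is_cosmooth_pvm D P) (diagP : diagonalizes D pi P).
Let pvmP : is_pvm D P := proj1 cpvmP.
Let hausX := @dual_hausdorff R A.
Implicit Types (E F K : set (dual R A)) (v w : V) (a : A) (c : Cplx R).

(** The image of P_F consists of vectors concentrated on F, so diagonalization
    can be applied with F itself as the domain of integration. *)
Lemma diagonalizes_eigen a c F v :
  compact_open_set F -> (forall x, F x -> dual_fun x a = c) ->
  pi (sd_inr t a) (P F v) = c *: P F v.
Proof.
move=> Fco Fc; have PFv : P F (P F v) = P F v.
  by rewrite (pvmI pvmP) ?setIid //; exact: Dco.
have [|n [G [d [Gco tG FG Gd ->]]]] := diagP a Fco.1 Fco.2 (v := P F v).
  by apply: concentrated_pvm => //; exact: Dco.
rewrite -[in RHS]PFv [X in P X (P F v)]FG (pvm_sum pvmP) //; first last.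
- by rewrite -FG; exact: Dco.
- by move=> i; exact: Dco.
rewrite scaler_sumr; apply: eq_bigr => i _.
(* Only on a nonempty piece is the constant d i forced to be c. *)
have [[x Gx]|G0] := pselect (G i !=set0).
  by rewrite -(Gd _ _ Gx) Fc // FG; exists i.
have -> : G i = set0 by apply/eqP/negPn/negP => /set0P.
by rewrite (pvm0 pvmP) !scaler0.
Qed.

Definition level_set K a c := K `&` [set x | dual_fun x a = c].

(** Diagonalization of the zero vector, which is concentrated on every set,
    already forces the evaluations to be locally constant. *)
Lemma evaluation_finite K a : compact_open_set K ->
  (forall c, compact_open_set (level_set K a c)) /\
  exists2 s : seq (Cplx R), uniq s
    & forall x, K x -> dual_fun x a \in s.
Proof.
move=> Kco.
have [|n [F [d [Fco tF KF Fd _]]]] := diagP a Kco.1 Kco.2 (v := 0).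
  by move=> E _; rewrite !linear0.
split=> [c|]; last first.
  exists (undup (codom d)); first exact: undup_uniq.
  by move=> x; rewrite KF mem_undup => -[i _ Fx]; rewrite (Fd _ _ Fx) codom_f.
split; last first.
  rewrite (_ : level_set K a c = \bigcup_(i in [set i | d i = c]) F i).
    by apply: bigcup_open => i _; case: (Fco i).
  rewrite /level_set KF; apply/seteqP; split=> x.
    by move=> [[i _ Fx] xc]; exists i => //=; rewrite -(Fd _ _ Fx).
  by move=> [i /= dic Fx]; split; [exists i | rewrite /= (Fd _ _ Fx)].
rewrite (_ : level_set K a c =
    K `&` ~` \bigcup_(i in [set i | d i <> c]) F i).
  apply: compact_closedI; first by case: Kco.
  by apply: open_closedC; apply: bigcup_open => i _; case: (Fco i).
apply/seteqP; split=> x [Kx xc]; split=> //.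
  by move=> [i /= dic Fx]; apply: dic; rewrite -(Fd _ _ Fx).
apply: contrapT => xc'; apply: xc; move: Kx; rewrite KF => -[i _ Fx].
by exists i => //= dic; apply: xc'; rewrite /= (Fd _ _ Fx).
Qed.

Variable W : {pred V}.
Hypotheses (Wsub : submod_closed W)
  (WA : forall a v, v \in W -> pi (sd_inr t a) v \in W).

(** On the vectors concentrated on K, the operator pi(a) is diagonalizable with
    the projections to its eigenspaces given by the level sets. *)
Lemma invariant_level_set K a c w : compact_open_set K ->
  P K w = w -> w \in W -> P (level_set K a c) w \in W.
Proof.
move=> Kco PKw Ww.
have [Lco [s us Ks]] := evaluation_finite a Kco.
have [cs|ncs] := boolP (c \in s); last first.
  rewrite (_ : level_set K a c = set0); first by rewrite (pvm0 pvmP) Wsub.1.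
  apply/seteqP; split=> // x [/Ks xs xc].
  by rewrite -xc xs in ncs.
apply: (@invariant_eigencomponents _ _ W (pi (sd_inr t a)) s
  (fun c => P (level_set K a c) w)) => // [|d _|]; first exact: WA.
  by apply: diagonalizes_eigen => // x [].
have KL : \bigcup_(i : 'I_(size s)) level_set K a s`_i = K.
  apply/seteqP; split=> [x [i _ []]//|x Kx].
  have xs := Ks x Kx; have xi : (index (dual_fun x a) s < size s)%N.
    by rewrite index_mem.
  by exists (Ordinal xi) => //; split=> //=; rewrite nth_index.
rewrite (big_nth 0) big_mkord.
rewrite -(pvm_sum pvmP (F := fun i : 'I_(size s) => level_set K a s`_i)).
- by rewrite KL PKw.
- by move=> i; exact/Dco/Lco.
- by rewrite KL; exact: Dco.
- move=> i j _ _ [x [[_ xi] [_ xj]]]; apply/val_inj/eqP.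
  by rewrite /= -(nth_uniq 0 _ _ us) //; apply/eqP; rewrite -xi.
Qed.

(** The intersection of F with a compact open set K on which w is concentrated
    belongs to the Boolean algebra of the subsets of K whose projections map
    the vectors of W concentrated on K into W. *)
Lemma invariant_compact_open F w :
  compact_open_set F -> w \in W -> P F w \in W.
Proof.
move=> Fco Ww; have [W0 WZD] := Wsub.
have [K Kco PK] := cpvmP.2 w.
rewrite PK; last exact: Dco.
have PKw : P K w = w by apply/(concentratedP DT pvmP _ (Dco Kco)).
pose G E := [/\ compact_open_set E, E `<=` K
  & forall u, P K u = u -> u \in W -> P E u \in W].
suff [_ _ ->//] : G (F `&` K).
apply: (separating_algebra_compact_open hausX Kco (G := G)).
- by move=> E [[]].
- by split=> // u ->.
- move=> E1 E2 [E1co E1K WE1] [E2co E2K WE2].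
  split=> [||u Ku Wu]; [exact: compact_openI|by move=> x [/E1K]|].
  rewrite -(pvmI pvmP _ (Dco E1co) (Dco E2co)); apply: WE1; last exact: WE2.
  by rewrite (pvmI pvmP _ (Dco Kco) (Dco E2co)) setIidr.
- move=> E [Eco EK WE]; split=> //.
  split=> [||u Ku Wu]; [exact: compact_openD|exact: subDsetl|].
  have := pvmD hausX Dco pvmP u Kco Eco; rewrite Ku (setIidr EK) => uE.
  rewrite -[P (K `\` E) u](addKr (P E u)) -uE -scaleN1r.
  by apply: WZD => //; exact: WE.
- move=> x y Kx Ky /dual_separated[a xya].
  exists (level_set K a (dual_fun x a)); last first.
    by split=> // -[_] /esym.
  split=> [||u Ku Wu]; [exact: (evaluation_finite a Kco).1|exact: subIsetl|].
  exact: invariant_level_set.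
- exact: compact_openI.
- exact: subIsetr.
Qed.

End Diagonalization.

(** * Representations and their systems of imprimitivity *)

(** Finiteness of the support matters: a sum of infinitely many nonzero terms is
    zero by convention, while T may kill all but finitely many of them. *)
Lemma linear_fsbig (K : nzRingType) (V V' : lmodType K) (T : {linear V -> V'})
    (I : choiceType) (f : I -> V) : finite_set [set i | f i != 0] ->
  T (\sum_(i \in setT) f i) = \sum_(i \in setT) T (f i).
Proof.
move=> /finite_seqP[s fs].
have f0 i : [set: I] i -> i \notin undup s -> f i = 0.
  move=> _; rewrite mem_undup; apply: contraNeq => fi0.
  by have : [set i | f i != 0] i by []; rewrite fs.
rewrite !(fsbigE (undup s)) ?undup_uniq //; first by rewrite linear_sum.
by move=> i iT /f0 ->; rewrite ?linear0.
Qed.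

Section Transport.
Variables (R : realType) (X : topologicalType) (V V' : lmodType (Cplx R)).
Variables (T : {linear V -> V'}) (Ti : {linear V' -> V}).
Hypotheses (TK : cancel T Ti) (TiK : cancel Ti T).
Variables (D : set (set X)) (P : set X -> {linear V -> V}).

Definition transport E : {linear V' -> V'} := T \o P E \o Ti.

Lemma transport_concentrated K v :
  concentrated D transport K v <-> concentrated D P K (Ti v).
Proof.
by split=> PK E DE; [apply: (can_inj TK); exact: PK | rewrite /= PK].
Qed.

Lemma transport_cosmooth : is_cosmooth_pvm D P -> is_cosmooth_pvm D transport.
Proof.
move=> [[[PT P0] PI PU] Pco]; split; last first.
  move=> v; have [K Kco PK] := Pco (Ti v).
  by exists K => //; apply/transport_concentrated.
split=> [|E F v DE DF|I E DE DU tE v].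
- by split=> v /=; rewrite ?PT // P0 linear0.
- by rewrite /= TK PI.
have [fin PUv] := PU I E DE DU tE (Ti v).
split; last by rewrite [LHS]/= PUv linear_fsbig.
rewrite (_ : [set i | _] = [set i | P (E i) (Ti v) != 0]) //.
apply/seteqP; split=> i /=; apply: contra_neq => PE0.
  by rewrite PE0 linear0.
by apply: (can_inj TK); rewrite PE0 linear0.
Qed.

End Transport.

Section Correspondence.
Variables (R : realType) (A : topologicalZmodType) (H : topologicalGroupType).
Variable t : {multiplicative H -> topAut A}.
Variable D : set (set (dual R A)).
Hypothesis DE : D = [set E | open E] \/ D = [set E | clopen E].
Let hausX := @dual_hausdorff R A.

Let DT : D setT.
Proof. by case: DE => -> /=; [exact: openT | exact: clopenT]. Qed.

Let Dco : @compact_open_set (dual R A) `<=` D.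
Proof. by case: DE => -> E Eco; [case: Eco | exact: compact_open_clopen]. Qed.

Lemma semidirect_factor (h : H) (a : A) :
  ((h, a) : semidirect t) = (sd_inr t a * sd_inl t h)%g.
Proof.
have [tD _ _ _ _] := topAutP (t 1%g).
have t0 : topAut_fun (t 1%g) 0 = 0.
  by apply: (addrI (topAut_fun (t 1%g) 0)); rewrite -tD !addr0.
by congr pair; rewrite /= ?mul1g // t0 addr0.
Qed.

Lemma rep_semidirect (V : lmodType (Cplx R)) (pi : smooth_rep (semidirect t) V)
    (h : H) (a : A) v :
  pi (h, a) v = pi (sd_inr t a) (pi (sd_inl t h) v).
Proof. by rewrite semidirect_factor; case: (rep_smooth pi) => _ ->. Qed.

(** For the class of all open sets this is where the uniqueness of the measure
    is essential: the inner regularization diagonalizes the representation just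
    as well, so it coincides with the given measure. *)
Lemma corresponding_inner_regular (V : lmodType (Cplx R))
    (pi : smooth_rep (semidirect t) V) (S : cosmooth_system t D V) E v :
  corresponding_system pi S -> D E ->
  exists2 F, compact_open_set F & sys_pvm S E v = sys_pvm S F v.
Proof.
move=> [_ diagP uniqP] DEE; have cpvmP := sys_cosmooth S.
case: DE => eqD; last first.
  have [K [Kc Ko] PK] := cpvmP.2 v.
  exists (E `&` K); last exact: PK.
  move: DEE; rewrite eqD => -[Eo Ecl].
  by split; [rewrite setIC; exact: compact_closedI | exact: openI].
subst D; rewrite -(uniqP (regularized hausX cpvmP)) //.
- have [Fco _ _] := inner_setP hausX cpvmP E v.
  by exists (inner_set hausX cpvmP E v).
- exact: regularized_pvm.
- move=> a w K Kc Ko /regularized_concentrated -/(_ (conj Kc Ko)) PK.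
  have [n [F [c [Fco tF KF Fc ->]]]] := diagP a w K Kc Ko PK.
  exists n, F, c; split=> //; apply: eq_bigr => i _.
  by rewrite regularized_compact.
Qed.

Lemma irreducible_corresponding (V : lmodType (Cplx R))
    (pi : smooth_rep (semidirect t) V) (S : cosmooth_system t D V) :
  corresponding_system pi S -> irreducible_rep pi <-> irreducible_system S.
Proof.
move=> corS; have [SH diagP _] := corS; have cpvmP := sys_cosmooth S.
split=> irr W Wsub.
  move=> WP WH; apply: irr => // -[h a] v Wv.
  rewrite rep_semidirect -SH; have := WH h v Wv.
  move: (sys_rep S h v) => u Wu; have [K [Kc Ko] PK] := cpvmP.2 u.
  have [n [F [c [Fco _ _ _ ->]]]] := diagP a u K Kc Ko PK.
  have [W0 WZD] := Wsub.
  elim/big_rec: _ => // i w _ Ww; apply: WZD => //.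
  by apply: WP => //; exact: Dco.
move=> Wpi; apply: irr => // [E v DEE Wv|h v Wv]; last first.
  by rewrite SH; exact: Wpi.
have [F Fco ->] := corresponding_inner_regular v corS DEE.
apply: (invariant_compact_open DT Dco cpvmP diagP Wsub) => // a w.
exact: Wpi.
Qed.

(** Transporting P along T gives a measure that diagonalizes pi', which can only
    be P'. *)
Lemma equivalent_rep_system (V V' : lmodType (Cplx R))
    (pi : smooth_rep (semidirect t) V) (pi' : smooth_rep (semidirect t) V')
    (S : cosmooth_system t D V) (S' : cosmooth_system t D V') :
  corresponding_system pi S -> corresponding_system pi' S' ->
  equivalent_rep pi pi' -> equivalent_system S S'.
Proof.
move=> [SH diagP _] [SH' _ uniqP'] [T [Ti [TK TiK pi'E]]].
exists T, Ti; split=> // [h v|E v DEE]; first by rewrite SH' SH.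
rewrite -(uniqP' (transport T Ti (sys_pvm S))) //.
  exact/transport_cosmooth/sys_cosmooth.
move=> a v' K Kc Ko /(transport_concentrated TK) PK.
have [n [F [c [Fco tF KF Fc piE]]]] := diagP a _ K Kc Ko PK.
exists n, F, c; split=> //; rewrite pi'E piE linear_sum.
by apply: eq_bigr => i _; rewrite linearZ.
Qed.

(** The operators pi(a) and pi'(a) have the same eigenvalues on the components
    of v and of T v along a partition on which x(a) is locally constant. *)
Lemma equivalent_system_rep (V V' : lmodType (Cplx R))
    (pi : smooth_rep (semidirect t) V) (pi' : smooth_rep (semidirect t) V')
    (S : cosmooth_system t D V) (S' : cosmooth_system t D V') :
  corresponding_system pi S -> corresponding_system pi' S' ->
  equivalent_system S S' -> equivalent_rep pi pi'.
Proof.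
move=> [SH diagP _] [SH' diagP' _] [T [Ti [TK TiK SS' PP']]].
have [pvmP Pco] := sys_cosmooth S.
exists T, Ti; split=> // -[h a] v'.
rewrite (rep_semidirect pi') (rep_semidirect pi).
rewrite -SH' SS' -SH; move: (sys_rep S h _) => v.
have [K Kco PK] := Pco v.
have [n [F [c [Fco tF KF Fc ->]]]] := diagP a v K Kco.1 Kco.2 PK.
have DF i : D (F i) by exact: Dco.
rewrite -[v in LHS](iffLR (concentratedP DT pvmP v (Dco Kco)) PK).
rewrite KF (pvm_sum pvmP) -?KF //; last exact: Dco.
rewrite !linear_sum; apply: eq_bigr => i _; rewrite !linearZ /=.
have -> : T (sys_pvm S (F i) v) = sys_pvm S' (F i) (T v) by rewrite PP' ?TK.
apply: (diagonalizes_eigen DT Dco (sys_cosmooth S') diagP' _ (Fco i)).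
exact: Fc.
Qed.

End Correspondence.

Theorem lemma2 (R : realType) (A : topologicalZmodType)
    (H : topologicalGroupType) (t : {multiplicative H -> topAut A})
    (D : set (set (dual R A))) :
  locally_compact [set: A] -> totally_disconnected [set: A] ->
  locally_compact [set: dual R A] -> totally_disconnected [set: dual R A] ->
  locally_compact [set: H] -> totally_disconnected [set: H] ->
  continuous (t : H -> topAut A) ->
  D = [set E | open E] \/ D = [set E | clopen E] ->
  (forall (V : lmodType (Cplx R)) (pi : smooth_rep (semidirect t) V)
      (S : cosmooth_system t D V),
    corresponding_system pi S ->
    (irreducible_rep pi <-> irreducible_system S)) /\
  (forall (V V' : lmodType (Cplx R)) (pi : smooth_rep (semidirect t) V)
      (pi' : smooth_rep (semidirect t) V')
      (S : cosmooth_system t D V) (S' : cosmooth_system t D V'),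
    corresponding_system pi S -> corresponding_system pi' S' ->
    (equivalent_rep pi pi' <-> equivalent_system S S')).
Proof.
move=> _ _ _ _ _ _ _ DE; split=> [V pi S|V V' pi pi' S S' corS corS'].
  exact: irreducible_corresponding.
by split; [exact: equivalent_rep_system | exact: equivalent_system_rep].
Qed.
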